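(* Let $M$ and $N$ be singular $(G,X)$-manifolds and let $f:M\to N$ be an a.e. $(G,X)$-morphism. Let $\mathcal E$ be the set of open subsets $U$ of $M$ such that $U\subset\mathrm{Reg}(M)$ and $f$ induces a $(G,X)$-morphism $U\to\mathrm{Reg}(N)$. Ordered by inclusion, $\mathcal E$ has a maximum.
   Context: $(G,X)$ is an analytical structure: $X$ is a connected, locally connected, Hausdorff topological space and $G$ is a group acting faithfully on $X$ by homeomorphisms such that for all $\phi_1,\phi_2\in G$ and every nonempty open $U\subset X$, if $\phi_1$ and $\phi_2$ agree on $U$ they agree on $X$. A $(G,X)$-atlas is an atlas of charts valued in open subsets of $X$ whose changes of charts are locally restrictions of elements of $G$; a $(G,X)$-morphism is a map which in such charts is locally the restriction of an element of $G$. A subset $U$ of a space $M$ is portly if it is open, dense and locally connected in $M$ (i.e. $W\cap U$ is connected for every open connected $W\subset M$). An almost everywhere (a.e.) $(G,X)$-structure on $M$ is given by a $(G,X)$-atlas on some portly subset of $M$. Any such a.e. structure has a maximal extension (extending both the portly domain and the atlas). A singular $(G,X)$-manifold is a locally connected Hausdorff second countable space $M$ endowed with a maximal a.e. $(G,X)$-structure; its regular locus $\mathrm{Reg}(M)$ is the portly subset on which this maximal structure is defined, and $\mathrm{Sing}(M)=M\setminus\mathrm{Reg}(M)$. An a.e. $(G,X)$-morphism $f:M\to N$ between singular $(G,X)$-manifolds is a continuous map for which there exist portly subsets $U\subset\mathrm{Reg}(M)$ and $V\subset\mathrm{Reg}(N)$ such that $f$ restricts to a $(G,X)$-morphism $U\to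 V$. *)

(* Defs.v *)
From HB Require Import structures.
From mathcomp Require Import all_boot all_order.
From mathcomp Require Import all_classical.
From mathcomp Require Import topology.

Set Implicit Arguments.
Unset Strict Implicit.
Unset Printing Implicit Defensive.

Local Open Scope classical_set_scope.

Definition locally_connected (T : topologicalType) : Prop :=
  forall (x : T) (U : set T), nbhs x U ->
    exists V : set T, [/\ open V, connected V, V x & V `<=` U].

(* Each [gx_act g] is a homeomorphism: it is continuous with continuous
   inverse [gx_act g^-1]. *)
Record analytical_structure (G : groupType) (X : topologicalType) : Type :=
  AnalyticalStructure {
    gx_act :> G -> X -> X;
    gx_act1 : forall x, gx_act 1%g x = x;
    gx_actM : forall g h x, gx_act (g * h)%g x = gx_act g (gx_act h x);
    gx_act_continuous : forall g, continuous (gx_act g);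
    gx_act_faithful : forall g h, gx_act g =1 gx_act h -> g = h;
    gx_act_analytic : forall (g h : G) (U : set X), open U -> U !=set0 ->
      (forall x, U x -> gx_act g x = gx_act h x) -> gx_act g =1 gx_act h;
    gx_connected : connected [set: X];
    gx_locally_connected : locally_connected X;
    gx_hausdorff : hausdorff_space X }.

(* A homeomorphism from an open subset of M onto an open subset of X.  The map
   is a total function of which only the values on [chart_dom] matter; as
   nothing below depends on the other values, a maximal atlas contains, with a
   chart, all the charts that coincide with it on its domain. *)
Record chart (M X : topologicalType) : Type := Chart {
  chart_dom : set M;
  chart_map :> M -> X;
  chart_dom_open : open chart_dom;
  chart_continuous : {within chart_dom, continuous chart_map};
  chart_inj : set_inj chart_dom chart_map;
  chart_open_map : forall W : set M,
    open W -> W `<=` chart_dom -> open (chart_map @` W) }.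

(* For phi injective on P: the map psi \o phi^-1, defined on phi @` P, is
   defined around each point of phi @` P and coincides there with the action of
   an element of G. *)
Definition locally_in_group (G : groupType) (X : topologicalType)
    (a : analytical_structure G X) (M : Type) (P : set M) (phi psi : M -> X) :
    Prop :=
  forall x, P x -> exists g : G,
    \forall p \near phi x, exists y, [/\ P y, phi y = p & psi y = a g p].

Definition compatible_charts (G : groupType) (X : topologicalType)
    (a : analytical_structure G X) (M : topologicalType) (c d : chart M X) :
    Prop :=
  locally_in_group a (chart_dom c `&` chart_dom d) c d.

Definition gx_atlas (G : groupType) (X : topologicalType)
    (a : analytical_structure G X) (M : topologicalType)
    (U : set M) (A : set (chart M X)) : Prop :=
  \bigcup_(c in A) chart_dom c = U /\
  forall c d, A c -> A d -> compatible_charts a c d.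

Definition portly (M : topologicalType) (U : set M) : Prop :=
  [/\ open U, dense U &
      forall W : set M, open W -> connected W -> connected (W `&` U)].

Record ae_structure (G : groupType) (X : topologicalType)
    (a : analytical_structure G X) (M : topologicalType) : Type := AeStructure {
  ae_dom : set M;
  ae_atlas : set (chart M X);
  ae_dom_portly : portly ae_dom;
  ae_atlasP : gx_atlas a ae_dom ae_atlas }.

Definition ae_extends (G : groupType) (X : topologicalType)
    (a : analytical_structure G X) (M : topologicalType)
    (S S' : ae_structure a M) : Prop :=
  ae_dom S `<=` ae_dom S' /\ ae_atlas S `<=` ae_atlas S'.

Definition ae_maximal (G : groupType) (X : topologicalType)
    (a : analytical_structure G X) (M : topologicalType)
    (S : ae_structure a M) : Prop :=
  forall S' : ae_structure a M, ae_extends S S' -> ae_extends S' S.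

Record singular_manifold (G : groupType) (X : topologicalType)
    (a : analytical_structure G X) : Type := SingularManifold {
  sm_space :> topologicalType;
  sm_locally_connected : locally_connected sm_space;
  sm_hausdorff : hausdorff_space sm_space;
  sm_second_countable : @second_countable sm_space;
  sm_structure : ae_structure a sm_space;
  sm_structure_maximal : ae_maximal sm_structure }.

Definition Reg (G : groupType) (X : topologicalType)
    (a : analytical_structure G X) (M : singular_manifold a) : set M :=
  ae_dom (sm_structure M).
Arguments Reg {G X a} M.

Definition Sing (G : groupType) (X : topologicalType)
    (a : analytical_structure G X) (M : singular_manifold a) : set M :=
  ~` Reg M.
Arguments Sing {G X a} M.

(* f restricts to a (G,X)-morphism U -> V, where U and V are open subsets of
   the regular loci with the induced (G,X)-structures.  Since [locally_in_group]
   requires d \o f \o c^-1 to be defined on a neighbourhood of each point, this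
   includes the continuity of f on U. *)
Definition gx_morphism (G : groupType) (X : topologicalType)
    (a : analytical_structure G X) (M N : singular_manifold a)
    (U : set M) (V : set N) (f : M -> N) : Prop :=
  set_fun U V f /\
  forall c d, ae_atlas (sm_structure M) c -> ae_atlas (sm_structure N) d ->
    locally_in_group a
      ((U `&` chart_dom c) `&` f @^-1` (V `&` chart_dom d)) c (d \o f).

Definition ae_gx_morphism (G : groupType) (X : topologicalType)
    (a : analytical_structure G X) (M N : singular_manifold a) (f : M -> N) :
    Prop :=
  continuous f /\
  exists (U : set M) (V : set N),
    [/\ portly U, U `<=` Reg M, portly V, V `<=` Reg N & gx_morphism U V f].

Definition regular_domains (G : groupType) (X : topologicalType)
    (a : analytical_structure G X) (M N : singular_manifold a) (f : M -> N) :
    set (set M) :=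
  [set U | [/\ open U, U `<=` Reg M & gx_morphism U (Reg N) f]].

(* Main.v *)
Require Import Defs.
From mathcomp Require Import all_boot all_order.
From mathcomp Require Import all_classical.
From mathcomp Require Import topology.

(** Being a (G,X)-morphism into a fixed target is a local condition on the
    source: it is tested at each point, by the existence of one element of G
    on some neighbourhood in a chart.  A union of open sets on which [f] is a
    morphism is therefore again one ([gx_morphism_bigcup]), so the union of all
    regular domains is itself a regular domain, and contains every other. *)

Local Open Scope classical_set_scope.

(** A point of the union lies in some member [F i]; the element of G found
    there still works in the union, since the preimages [y] that it needs near
    that point are in [F i] already. *)
Lemma gx_morphism_bigcup (G : groupType) (X : topologicalType)
    (a : analytical_structure G X) (M N : singular_manifold a)
    (I : Type) (D : set I) (F : I -> set M) (V : set N) (f : M -> N) :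
  (forall i, D i -> gx_morphism (F i) V f) ->
  gx_morphism (\bigcup_(i in D) F i) V f.
Proof.
move=> Ff; split=> [x [i Di Fix]|c d Ac Ad x [[[i Di Fix] cx] fx]].
  by have [fV _] := Ff i Di; exact: fV.
have [_ /(_ c d Ac Ad x)] := Ff i Di.
case=> [|g gP]; first by split.
exists g; apply: filterS gP => p [y [[[Fiy cy] fy] cyp dy]].
by exists y; split=> //; split=> //; split=> //; exists i.
Qed.

Theorem lemma3p8 (G : groupType) (X : topologicalType)
    (a : analytical_structure G X) (M N : singular_manifold a) (f : M -> N)
    (hf : ae_gx_morphism f) :
  exists Umax : set M, regular_domains f Umax /\
    forall U : set M, regular_domains f U -> U `<=` Umax.
Proof.
exists (\bigcup_(U in regular_domains f) U); split; last first.
  by move=> U EU; exact: bigcup_sup.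
split.
- by apply: bigcup_open => U [].
- by apply: bigcup_sub => U [].
- by apply: gx_morphism_bigcup => U [].
Qed.
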